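(* Let $\mathbf{K}$ be an $\mathbf{o}$-symmetric convex body in $\mathbb{E}^d$ which is smooth or strictly convex. Then: (a) For $d\in\{1,2,3,4\}$ we have $H_{\rm sep}(\mathbf{K})=2d$. Moreover, for $d\in\{1,2,3,4\}$, in any separable Hadwiger configuration $2\mathbf{x}_1+\mathbf{K},\ldots,2\mathbf{x}_{2d}+\mathbf{K}$ of $\mathbf{K}$ with $2d$ members, the vectors $\mathbf{x}_1,\ldots,\mathbf{x}_{2d}$ are $d$ pairs of opposite vectors, and picking one vector from each pair yields an Auerbach basis of $\mathbf{K}$. (b) $H_{\rm sep}(\mathbf{K})\leq 2^{d+1}-3$ for all $d\geq 5$.
   Context: $\mathbb{E}^d$ is $d$-dimensional Euclidean space with origin $\mathbf{o}$. A convex body is a compact convex subset of $\mathbb{E}^d$ with nonempty interior. It is $\mathbf{o}$-symmetric if $\mathbf{K}=-\mathbf{K}$; smooth if at every boundary point it is supported by a unique hyperplane; strictly convex if its boundary contains no nontrivial line segment. A packing of translates of $\mathbf{K}$ is a family of translates with pairwise disjoint interiors; two members touch if they intersect. A packing of translates of $\mathbf{K}$ is totally separable if any two members can be separated by a hyperplane of $\mathbb{E}^d$ that is disjoint from the interior of every member of the packing. A separable Hadwiger configuration of $\mathbf{K}$ is a family of translates of $\mathbf{K}$ that all touch $\mathbf{K}$ and, together with $\mathbf{K}$, form a totally separable packing in $\mathbb{E}^d$. The separable Hadwiger number $H_{\rm sep}(\mathbf{K})$ is the maximum size of a separable Hadwiger configuration of $\mathbf{K}$ (the body $\mathbf{K}$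 itself is not counted). For $\mathbf{o}$-symmetric $\mathbf{K}$, each member of a separable Hadwiger configuration has the form $2\mathbf{x}+\mathbf{K}$ with $\mathbf{x}\in\mathrm{bd}\,\mathbf{K}$. An Auerbach basis of an $\mathbf{o}$-symmetric convex body $\mathbf{K}$ in $\mathbb{E}^d$ is a set of $d$ points on the boundary of $\mathbf{K}$ that form a basis of $\mathbb{E}^d$ and have the property that the hyperplane through any one of them, parallel to the other $d-1$, supports $\mathbf{K}$. *)

(* Defs.v *)
From HB Require Import structures.
From mathcomp Require Import all_boot all_order all_algebra.
From mathcomp Require Import all_classical all_reals all_analysis.

Set Implicit Arguments.
Unset Strict Implicit.
Unset Printing Implicit Defensive.

Import Order.TTheory GRing.Theory Num.Theory.
Import numFieldNormedType.Exports.

Local Open Scope classical_set_scope.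
Local Open Scope ring_scope.
Local Open Scope card_scope.

(* E^d is ['rV[R]_d]; its library topology (entrywise, i.e. that of the
   sup norm) is the Euclidean one. *)

Definition boundary (T : topologicalType) (A : set T) : set T :=
  closure A `\` A°.

Section Geometry.
Context {R : realType} {d : nat}.
Implicit Types (K H A B : set 'rV[R]_d) (u x y : 'rV[R]_d) (c : R).

Definition dot u x : R := \sum_(i < d) u ord0 i * x ord0 i.

Definition hyperplane u c : set 'rV[R]_d := [set x | dot u x = c].

Definition segment x y : set 'rV[R]_d :=
  [set (1 - t) *: x + t *: y | t in `[0, 1]].

Definition convex_body K : Prop :=
  [/\ compact K, convex_set K & K° !=set0].

Definition o_symmetric K : Prop := K = [set - x | x in K].

Definition supporting_hyperplane K H : Prop :=
  exists u c, [/\ u != 0, H = hyperplane u c,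
    (forall x, K x -> dot u x <= c) & K `&` H !=set0].

Definition smooth K : Prop :=
  forall x, boundary K x -> exists! H, supporting_hyperplane K H /\ H x.

Definition strictly_convex K : Prop :=
  forall x y, segment x y `<=` boundary K -> x = y.

Definition translate x K : set 'rV[R]_d := [set x + y | y in K].

(* A hyperplane determines its normal vector only up to sign, so fixing the
   sides of A and B is no loss. *)
Definition separates H A B : Prop :=
  exists u c, [/\ u != 0, H = hyperplane u c,
    (forall x, A x -> dot u x <= c) & (forall x, B x -> c <= dot u x)].

(* Families are indexed, so distinct indices must give members with disjoint
   interiors (in particular, for a convex body, distinct members). *)
Definition translate_packing K (I : Type) (F : I -> set 'rV[R]_d) : Prop :=
  (forall i, exists x, F i = translate x K) /\
  trivIset [set: I] (fun i => (F i)°).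

Definition totally_separable_packing K (I : Type) (F : I -> set 'rV[R]_d) :
    Prop :=
  translate_packing K F /\
  forall i j, i <> j -> exists H,
    separates H (F i) (F j) /\ forall k, H `&` (F k)° = set0.

(* The body K is adjoined to the family as the member of index [None]. *)
Definition separable_Hadwiger_configuration K (I : Type)
    (F : I -> set 'rV[R]_d) : Prop :=
  (forall i, F i `&` K !=set0) /\
  totally_separable_packing K (fun o : option I => oapp F K o).

(* n is the maximum size of a configuration; infinite configurations are
   among the competitors. *)
Definition separable_Hadwiger_number K (n : nat) : Prop :=
  (exists F : 'I_n -> set 'rV[R]_d, separable_Hadwiger_configuration K F) /\
  forall (I : Type) (F : I -> set 'rV[R]_d),
    separable_Hadwiger_configuration K F -> [set: I] #<= `I_n.

Definition Auerbach_basis K (b : 'I_d -> 'rV[R]_d) : Prop :=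
  [/\ forall i, boundary K (b i),
      basis_of {: 'rV[R]_d} [seq b i | i : 'I_d] &
      forall i, supporting_hyperplane K
        [set b i + \sum_(j < d | j != i) a j *: b j | a in [set: 'I_d -> R]]].

End Geometry.

(* Main.v *)
Require Import Defs.
From HB Require Import structures.
From mathcomp Require Import all_boot all_order all_algebra perm.
From mathcomp Require Import all_classical all_reals all_analysis.
From mathcomp Require Import zify lra ring.

Set Implicit Arguments.
Unset Strict Implicit.
Unset Printing Implicit Defensive.
Import Order.TTheory GRing.Theory Num.Theory.
Import numFieldNormedType.Exports.
Local Open Scope ring_scope.

(** Let [2 x_i + K] be the members of a separable Hadwiger configuration.
    The hyperplane that separates [K] from the [i]-th member supports [K] at
    [x_i], so there is a functional [f_i] with [f_i <= 1] on [K] and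
    [f_i(x_i) = 1]. Total separability and the regularity of [K] turn the
    avoidance of the other interiors into [-1 <= f_i(x_j) <= 0] for [j <> i]
    ([configuration_contacts]), and from here on only the matrix [A] of the
    numbers [f_i(x_j)], which has rank at most [d], and the points
    themselves matter.

    In every dimension, [f_i - f_j] attains its maximum over the [x_k] at
    [x_i] and its minimum at [x_j]. The points are thus antipodal, and there
    are at most [2 ^ d] of them ([card_le_pow2]), which implies the bound of
    (b).

    For (a), suppose first that no entry of [A] is [-1]. Then a linear
    relation among rows of [A] cannot have just one or two positive
    coefficients ([pos_ge3]), nor just one or two negative ones. If there
    were [2 d] rows or more, there would be so many relations that one with
    few coefficients exists: for [d = 1], one with at most two; for [d = 2]
    and [d = 3], one with at most five, of both signs; for [d = 4],
    elimination between semipositive relations gives one with at most five,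
    of both signs ([rank4_card_lt8]). If [f_i(x_j) = -1],
    then strict convexity forces [x_j = - x_i], and smoothness forces [f_j =
    - f_i]; either way, deleting the rows and columns [i] and [j] of [A]
    lowers its rank ([rank_restriction_remove]), and induction shows that at
    most [2 d] rows are possible, with equality only if they all come in
    such pairs ([opposite_partner]). In that case the points and the
    functionals of a choice of one index per pair are dual bases, that is,
    an Auerbach basis ([extremal_configuration]).

    Conversely, an Auerbach basis exists by maximizing a determinant
    ([Auerbach_exists]), and its points with their opposites give a
    configuration with [2 d] members ([cross_configuration]). *)

(** * Finite sets and involutions *)

Section FiniteSubsets.
Import mathcomp.boot.fintype mathcomp.boot.finset.

Lemma subset_of_card (T : finType) (U : {set T}) k :
  (k <= #|U|)%N -> exists2 S : {set T}, S \subset U & #|S| = k.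
Proof.
move=> leU; exists [set x in take k (enum U)].
  by apply/subsetP=> x; rewrite inE => /mem_take; rewrite mem_enum.
rewrite cardsE (card_uniqP _) ?take_uniq ?enum_uniq // size_takel //.
by rewrite -cardE.
Qed.

Lemma superset_of_card (T : finType) (C U : {set T}) k :
  C \subset U -> (#|C| <= k <= #|U|)%N ->
  exists S : {set T}, [/\ C \subset S, S \subset U & #|S| = k].
Proof.
move=> sCU /andP[leC leU].
have [S sS cS] : exists2 S : {set T}, S \subset U :\: C & #|S| = (k - #|C|)%N.
  by apply: subset_of_card; rewrite cardsD (setIidPr sCU) leq_sub2r.
have dCS : C :&: S = set0.
  apply/eqP; rewrite setI_eq0 disjoint_sym disjoints_subset.
  by apply: subset_trans sS _; rewrite setDE subsetIr.
exists (C :|: S); split; first exact: subsetUl.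
  by rewrite subUset sCU (subset_trans sS) ?subsetDl.
by rewrite cardsU dCS cards0 subn0 cS subnKC.
Qed.

(** One index is taken from each orbit: the one below its image. *)
Lemma involution_pairs n (opp : 'I_(2 * n) -> 'I_(2 * n)) :
  involutive opp -> (forall i, opp i != i) ->
  exists p : 'I_n * bool -> 'I_(2 * n),
    bijective p /\ forall k s, opp (p (k, s)) = p (k, ~~ s).
Proof.
move=> oppK opp_neq; pose S := [set i : 'I_(2 * n) | (i < opp i)%N].
have cS : #|S| = n.
  have oS : ~: S = opp @: S.
    apply/setP=> i; rewrite !inE -leqNgt.
    apply/idP/imsetP => [oi|[j + ->]]; last by rewrite inE oppK => /ltnW.
    exists (opp i); last by rewrite oppK.
    by rewrite inE oppK ltn_neqAle oi andbT; exact: opp_neq.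
  have := cardsC S; rewrite oS card_imset; last exact: inv_inj oppK.
  by rewrite addnn -mul2n card_ord => /eqP; rewrite eqn_pmul2l // => /eqP.
pose e (k : 'I_n) : 'I_(2 * n) := enum_val (cast_ord (esym cS) k).
have eS k : (e k < opp (e k))%N.
  by have := enum_valP (cast_ord (esym cS) k); rewrite inE.
have einj : injective e by move=> k l /enum_val_inj /cast_ord_inj.
have eopp k l : e k <> opp (e l).
  move=> ekl; have := eS k; rewrite ekl oppK => /(ltn_trans (eS l)).
  by rewrite ltnn.
exists (fun k => if k.2 then e k.1 else opp (e k.1)); split; last first.
  by move=> k []; rewrite /= ?oppK.
apply: inj_card_bij; last by rewrite card_prod !card_ord card_bool mulnC.
case=> [k []] [l []] /=; first by move/einj->.
- by move/eopp.
- by move/esym/eopp.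
- by move/(inv_inj oppK)/einj->.
Qed.

End FiniteSubsets.

(** * Linear dependencies in matrices with small off-diagonal entries *)

Section Dependencies.
Import mathcomp.boot.fintype mathcomp.boot.finset.
Context {R : realFieldType} {n : nat}.
Implicit Types (A : 'M[R]_n) (U T C : {set 'I_n}) (v w : 'rV[R]_n).

(** The principal submatrix on [U], padded with zeros so that all of them live
    in the same type. *)
Definition restriction A U : 'M[R]_n :=
  \matrix_(i, j) (if (i \in U) && (j \in U) then A i j else 0).

Definition dependency A U v : Prop :=
  (forall i, i \notin U -> v 0 i = 0) /\
  (forall k, k \in U -> \sum_i v 0 i * A i k = 0).

Definition supp v : {set 'I_n} := [set i | v 0 i != 0].
Definition pos v : {set 'I_n} := [set i | 0 < v 0 i].

Lemma supp_posU v : supp v = pos v :|: pos (- v).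
Proof. by apply/setP=> i; rewrite !inE mxE oppr_gt0 neq_lt orbC. Qed.

Lemma card_supp v : #|supp v| = (#|pos v| + #|pos (- v)|)%N.
Proof.
rewrite supp_posU cardsU (_ : _ :&: _ = set0) ?cards0 ?subn0 //.
by apply/setP=> i; rewrite !inE mxE oppr_gt0; case: ltgtP.
Qed.

Lemma dependencyN A U v : dependency A U v -> dependency A U (- v).
Proof.
move=> [v0 vA]; split=> [i /v0|k kU]; first by rewrite mxE => ->; rewrite oppr0.
transitivity (- \sum_i v 0 i * A i k); last by rewrite vA // oppr0.
by rewrite -sumrN; apply: eq_bigr => i _; rewrite mxE mulNr.
Qed.

Lemma dependency_comb A U a b v w :
  dependency A U v -> dependency A U w -> dependency A U (a *: v - b *: w).
Proof.
move=> [v0 vA] [w0 wA]; split=> [i iU|k kU].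
  by rewrite !mxE v0 // w0 // !mulr0 subr0.
transitivity (a * (\sum_i v 0 i * A i k) - b * (\sum_i w 0 i * A i k)).
  by rewrite !mulr_sumr -sumrB; apply: eq_bigr => i _; rewrite !mxE; ring.
by rewrite vA // wA // !mulr0 subr0.
Qed.

(** Counting dimensions: [#|T|] unknown coefficients against at most [r]
    equations from the rank and [e] prescribed by the columns of [c]. *)
Lemma dependency_exists A U T e (c : 'M[R]_(n, e)) r :
  T \subset U -> (\rank (restriction A U) <= r)%N -> (r + e < #|T|)%N ->
  exists v, [/\ dependency A U v, v != 0, supp v \subset T & v *m c = 0].
Proof.
move=> sTU rA cT.
pose B : 'M[R]_(#|T|, n) := \matrix_(i, j) (enum_val i == j)%:R.
pose M := row_mx (B *m restriction A U) (B *m c).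
have : kermx M != 0.
  rewrite -mxrank_eq0 mxrank_ker subn_eq0 -ltnNge; apply: leq_ltn_trans cT.
  rewrite -mxrank_tr tr_row_mx -addsmxE.
  apply: leq_trans (mxrank_adds_leqif _ _) _; rewrite !mxrank_tr leq_add //.
    exact: leq_trans (mxrankM_maxr _ _) rA.
  exact: rank_leq_col.
case/rowV0Pn=> w /sub_kermxP; rewrite mul_mx_row => /eqP.
rewrite row_mx_eq0 => /andP[/eqP wA /eqP wc] w0.
have vE j : (w *m B) 0 j = \sum_i w 0 i * (enum_val i == j)%:R.
  by rewrite mxE; apply: eq_bigr => i _; rewrite mxE.
have vT j : j \notin T -> (w *m B) 0 j = 0.
  move=> jT; rewrite vE big1 // => i _; case: eqP => [ij|]; rewrite ?mulr0 //.
  by rewrite -ij enum_valP in jT.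
have vU j : j \notin U -> (w *m B) 0 j = 0.
  by move=> jU; apply: vT; apply: contra jU; exact: (subsetP sTU).
exists (w *m B); split=> [|||]; last by rewrite -mulmxA.
- split=> // k kU.
  move/matrixP/(_ 0 k): wA; rewrite mulmxA !mxE => wA; rewrite -[RHS]wA.
  apply: eq_bigr => i _; rewrite [restriction _ _ _ _]mxE kU andbT.
  by case: ifPn => // /vU ->; rewrite !mul0r.
- apply: contraNneq w0 => wB; apply/eqP/rowP=> i.
  move/rowP/(_ (enum_val i)): wB; rewrite vE (bigD1 i) //= eqxx mulr1.
  rewrite big1 ?addr0; first by move->; rewrite !mxE.
  by move=> j ji; rewrite (inj_eq enum_val_inj) (negPf ji) mulr0.
- by apply/subsetP=> j; rewrite inE; apply: contraR => /vT ->.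
Qed.

Section NoOpposite.
Variables (A : 'M[R]_n) (U : {set 'I_n}).
Hypothesis Adiag : forall i, i \in U -> A i i = 1.
Hypothesis Aoff : forall i j, i \in U -> j \in U -> i != j -> -1 < A i j <= 0.

Lemma supp_sub v : dependency A U v -> supp v \subset U.
Proof.
by case=> v0 _; apply/subsetP=> i; rewrite inE; apply: contraR => /v0 ->.
Qed.

(** At the index [k] of the largest coefficient, the [k]-th equation has the
    term [v 0 k] on the diagonal, the negative coefficients contribute
    nonnegative terms, and a single further positive coefficient contributes
    more than [- v 0 k].  So one other positive coefficient is not enough to
    balance the equation. *)
Lemma pos_ge3 v : dependency A U v -> pos v != set0 -> (3 <= #|pos v|)%N.
Proof.
move=> dv /set0Pn[i0 i0P]; rewrite leqNgt; apply/negP=> cP.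
have [k kP kmax] := @arg_maxP _ _ _ i0 (mem (pos v)) (fun i => v 0 i) i0P.
have sPU i : i \in pos v -> i \in U.
  by rewrite inE => vi; apply: (subsetP (supp_sub dv)); rewrite inE gt_eqF.
have {}kP : k \in pos v by [].
have vk : 0 < v 0 k by move: kP; rewrite inE.
have kU := sPU _ kP.
have := dv.2 k kU; rewrite (bigD1 k) //= Adiag // mulr1 => /eqP.
apply/negP; rewrite gt_eqF //.
(* [cP] leaves at most one index other than [k] with a positive coefficient *)
have [/eqP PE|] := boolP (pos v :\ k == set0).
  apply: ltr_pwDl => //; apply: sumr_ge0 => i ik.
  have : i \notin pos v :\ k by rewrite PE inE.
  rewrite !inE ik /= -leNgt => vi.
  have [iU|/dv.1->] := boolP (i \in U); last by rewrite mul0r.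
  by rewrite mulr_le0 //; case/andP: (Aoff iU kU ik).
case/set0Pn=> j; rewrite in_setD1 => /andP[jk jP].
have PE i : i != k -> i != j -> v 0 i <= 0.
  move=> ik ij; rewrite leNgt; apply: contraTN cP => vi; rewrite -leqNgt.
  have : [set i; j; k] \subset pos v.
    apply/subsetP=> x; rewrite !inE => /orP[/orP[]|] /eqP-> //.
    by move: jP; rewrite inE.
  move/subset_leq_card; apply: leq_trans.
  by rewrite setUC cardsU1 cards2 !inE negb_or eq_sym ik eq_sym jk ij.
rewrite (bigD1 j) //= addrA ltr_pwDl //; last first.
  apply: sumr_ge0 => i /andP[ik ij].
  have [iU|/dv.1->] := boolP (i \in U); last by rewrite mul0r.
  by rewrite mulr_le0 ?PE //; case/andP: (Aoff iU kU ik).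
have vj : 0 < v 0 j by move: jP; rewrite inE.
have vjk : v 0 j <= v 0 k by apply: kmax.
have /andP[a1 a2] := Aoff (sPU _ jP) kU jk.
by nra.
Qed.

Lemma dependency_supp_ge3 v :
  dependency A U v -> v != 0 -> (3 <= #|supp v|)%N.
Proof.
move=> dv; apply: contraNT; rewrite card_supp -ltnNge => c3.
have p0 : pos v = set0.
  apply: contraTeq c3 => /(pos_ge3 dv).
  by rewrite -leqNgt => /leq_trans -> //; rewrite leq_addr.
have n0 : pos (- v) = set0.
  apply: contraTeq c3 => /(pos_ge3 (dependencyN dv)).
  by rewrite -leqNgt => /leq_trans -> //; rewrite leq_addl.
apply/eqP/rowP=> i; rewrite mxE; apply/eqP; apply: contraFT (in_set0 i) => vi.
by rewrite -(setU0 set0) -{1}p0 -n0 -supp_posU inE.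
Qed.

(** A dependency with coefficients of both signs has at least three of each. *)
Lemma small_dependency_sign v :
  dependency A U v -> (#|supp v| <= 5)%N -> pos v = set0 \/ pos (- v) = set0.
Proof.
move=> dv; rewrite card_supp.
have [->|/(pos_ge3 dv) p3] := eqVneq (pos v) set0; first by left.
have [->|/(pos_ge3 (dependencyN dv)) n3] := eqVneq (pos (- v)) set0.
  by right.
by lia.
Qed.

Lemma small_dependency_nosum v :
  dependency A U v -> (#|supp v| <= 5)%N -> \sum_i v 0 i = 0 -> v = 0.
Proof.
move=> dv c5; wlog: v dv c5 / pos v = set0 => [hw|p0 s0].
  have [p0|n0] := small_dependency_sign dv c5; first exact: hw.
  move=> s0; apply: oppr_inj; rewrite oppr0; apply: hw => //.
  - exact: dependencyN.
  - by rewrite card_supp opprK addnC -card_supp.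
  - by under eq_bigr do rewrite mxE; rewrite sumrN s0 oppr0.
have vle i : 0 <= - v 0 i.
  rewrite oppr_ge0 leNgt; apply/negP => vi.
  by have := in_set0 i; rewrite -p0 inE vi.
have ns0 : \sum_i - v 0 i = 0 by rewrite sumrN s0 oppr0.
apply/rowP=> i; rewrite mxE; apply/eqP; rewrite -oppr_eq0; apply/eqP.
exact: (psumr_eq0P _ ns0).
Qed.

Definition semipositive_dependency v : Prop :=
  [/\ dependency A U v, v != 0 & pos (- v) = set0].

Lemma semipositive_ge3 v : semipositive_dependency v -> (3 <= #|supp v|)%N.
Proof. by case=> dv v0 _; exact: dependency_supp_ge3. Qed.

Lemma semipositive_gt0 v i :
  semipositive_dependency v -> i \in supp v -> 0 < v 0 i.
Proof. by case=> _ _ n0; rewrite supp_posU n0 setU0 inE. Qed.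

Lemma semipositive_exists (T : {set 'I_n}) :
  (\rank (restriction A U) <= 4)%N -> T \subset U -> #|T| = 5%N ->
  exists2 v, semipositive_dependency v & supp v \subset T.
Proof.
move=> rA sTU cT.
have [|v [dv v0 vT _]] := dependency_exists (0 : 'M[R]_(n, 0)) sTU rA.
  by rewrite cT.
have c5 : (#|supp v| <= 5)%N by rewrite -cT subset_leq_card.
have [p0|n0] := small_dependency_sign dv c5; last by exists v.
exists (- v); last first.
  by rewrite (_ : supp (- v) = supp v) // !supp_posU opprK setUC.
by split; [exact: dependencyN|rewrite oppr_eq0|rewrite opprK].
Qed.

(** Eliminating the common index [e] leaves a dependency that is positive at
    [i] and negative at [j], hence one with at least six indices besides
    [e]. *)
Lemma semipositive_overlap v w e i j :
  semipositive_dependency v -> semipositive_dependency w ->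
  e \in supp v -> e \in supp w -> i \in supp v -> i \notin supp w ->
  j \in supp w -> j \notin supp v -> (6 < #|supp v :|: supp w|)%N.
Proof.
move=> cv cw ev ew iv iw jw jv; rewrite ltnNge; apply/negP => c6.
have [[dv _ _] [dw _ _]] := (cv, cw).
pose z := w 0 e *: v - v 0 e *: w.
have dz : dependency A U z by exact: dependency_comb.
have ze : z 0 e = 0 by rewrite !mxE; ring.
have zs : (#|supp z| <= 5)%N.
  have : supp z \subset (supp v :|: supp w) :\ e.
    apply/subsetP=> k; rewrite !inE.
    have [->|ke /=] := eqVneq k e; first by rewrite ze eqxx.
    apply: contraNT; rewrite negb_or !negbK => /andP[/eqP vk /eqP wk].
    by rewrite !mxE vk wk !mulr0 subr0.
  move/subset_leq_card/leq_trans; apply.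
  by move: c6; rewrite (cardsD1 e) !inE; move: ev; rewrite inE => ->.
have zi : i \in pos z.
  rewrite inE !mxE; move: iw; rewrite inE negbK => /eqP->.
  by rewrite mulr0 subr0 mulr_gt0 // semipositive_gt0.
have zj : j \in pos (- z).
  rewrite inE !mxE; move: jv; rewrite inE negbK => /eqP->.
  by rewrite mulr0 sub0r opprK mulr_gt0 // semipositive_gt0.
have [z0|z0] := small_dependency_sign dz zs.
  by rewrite z0 inE in zi.
by rewrite z0 inE in zj.
Qed.

(** Let [C] be a smallest support of a semipositive dependency.  In a
    six-element set containing [C], the dependency found after deleting a point
    of [C] has support disjoint from [C], by [semipositive_overlap]; as supports
    have at least three elements, [#|C| = 3] and every three-element set
    disjoint from [C] is a support.  With eight indices, two such sets can be
    chosen that share two elements, and they contradict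
    [semipositive_overlap]. *)
Lemma rank4_card_lt8 : (\rank (restriction A U) <= 4)%N -> (#|U| < 8)%N.
Proof.
move=> rA; rewrite ltnNge; apply/negP=> U8.
have ex5 T := @semipositive_exists T rA.
pose is_supp (C : {set 'I_n}) :=
  `[< exists2 v, semipositive_dependency v & supp v = C >].
have [T0 sT0 cT0] := subset_of_card (leq_trans (isT : 5 <= 8)%N U8).
have [v0 cv0 v0T] := ex5 _ sT0 cT0.
have C0 : is_supp (supp v0) by apply/asboolP; exists v0.
have [C /asboolP[v cv vC] Cmin] := arg_minnP (fun C : {set 'I_n} => #|C|) C0.
have C3 : (3 <= #|C|)%N by rewrite -vC semipositive_ge3.
have sCU : C \subset U by rewrite -vC; apply: supp_sub; case: cv.
have compl T : C \subset T -> T \subset U -> #|T| = 6%N ->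
    #|C| = 3%N /\ exists2 w, semipositive_dependency w & supp w = T :\: C.
  move=> sCT sTU cT.
  have [c cC] : exists c, c \in C.
    by apply/set0Pn; rewrite -card_gt0; exact: leq_trans C3.
  have cD : #|T :\ c| = 5%N.
    by have := cardsD1 c T; rewrite (subsetP sCT) // cT add1n => -[<-].
  have [w cw wT] := ex5 _ (subset_trans (subsetDl _ _) sTU) cD.
  have w3 := semipositive_ge3 cw.
  have cw' : c \notin supp w by apply/negP=> /(subsetP wT); rewrite !inE eqxx.
  have wC : (#|C| <= #|supp w|)%N by apply: Cmin; apply/asboolP; exists w.
  have wT' : supp w \subset T := subset_trans wT (subsetDl _ _).
  have dis : [disjoint C & supp w].
    apply/pred0P=> e /=; apply/negbTE/negP=> /andP[eC ew].
    have /subsetPn[j jw jC] : ~~ (supp w \subset C).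
      apply: contraL wC => sw; rewrite -ltnNge; apply: proper_card.
      by rewrite properE sw; apply/subsetPn; exists c.
    have := @semipositive_overlap v w e c j cv cw.
    rewrite vC => /(_ eC ew cC cw' jw jC).
    by rewrite ltnNge -cT subset_leq_card // subUset sCT.
  have wTC : supp w \subset T :\: C by rewrite subsetD wT' disjoint_sym.
  have := cardsD T C; rewrite (setIidPr sCT) cT => cTC.
  have := subset_leq_card wTC; rewrite cTC => wle.
  have C3' : #|C| = 3%N by move: C3 w3 wle; clear; lia.
  split=> //; exists w => //; apply/eqP; rewrite eqEcard wTC cTC C3'.
  exact: w3.
have C3' : #|C| = 3%N.
  have [||T [sCT sTU cT]] := @superset_of_card _ C U 6; rewrite ?sCU //.
    apply/andP; split; last exact: leq_trans U8.
    apply: (@leq_trans 5) => //; rewrite -cT0.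
    by apply: leq_trans (Cmin _ C0) (subset_leq_card v0T).
  by have [] := compl T sCT sTU cT.
have compl3 (X : {set 'I_n}) : X \subset U :\: C -> #|X| = 3%N ->
    exists2 w, semipositive_dependency w & supp w = X.
  rewrite subsetD => /andP[sXU dXC] cX.
  have [] := compl (C :|: X); rewrite ?subsetUl ?subUset ?sCU //.
    by rewrite cardsU C3' cX (disjoint_setI0 _) ?cards0 // disjoint_sym.
  move=> _ [w cw ws]; exists w => //.
  by rewrite ws setDUl setDv set0U; apply/setDidPl.
(* [S :\ a] and [S :\ b] are the two overlapping supports *)
have [S sS cS] : exists2 S : {set 'I_n}, S \subset U :\: C & #|S| = 4%N.
  by apply: subset_of_card; rewrite cardsD (setIidPr sCU) C3'; lia.
have [a aS] : exists a, a \in S by apply/set0Pn; rewrite -card_gt0 cS.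
have cSa : #|S :\ a| = 3%N.
  by have := cardsD1 a S; rewrite aS cS add1n => -[<-].
have [b] : exists b, b \in S :\ a by apply/set0Pn; rewrite -card_gt0 cSa.
rewrite in_setD1 => /andP[ba bS].
have cSb : #|S :\ b| = 3%N.
  by have := cardsD1 b S; rewrite bS cS add1n => -[<-].
have [e] : exists e, e \in S :\ a :\ b.
  apply/set0Pn; rewrite -card_gt0.
  by have := cardsD1 b (S :\ a); rewrite !inE ba bS cSa add1n => -[<-].
rewrite !in_setD1 => /and3P[eb ea eS].
have [v1 c1 s1] := compl3 _ (subset_trans (subsetDl _ _) sS) cSa.
have [v2 c2 s2] := compl3 _ (subset_trans (subsetDl _ _) sS) cSb.
suff : (6 < #|S :\ a :|: S :\ b|)%N.
  apply/negP; rewrite -leqNgt; apply: (@leq_trans #|S|); last by rewrite cS.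
  by apply: subset_leq_card; rewrite subUset !subsetDl.
rewrite -s1 -s2; apply: (@semipositive_overlap v1 v2 e b a) => //;
  rewrite ?s1 ?s2 !inE ?eqxx //.
- by rewrite ea.
- by rewrite eb.
- by rewrite ba.
- by rewrite eq_sym ba.
Qed.

(** For [r <= 1] there is a dependency on [r + 1 <= 2] indices.  For [r = 2, 3],
    one on [r + 2 <= 5] indices with zero coefficient sum, so with both signs.
    Either is too short. *)
Lemma card_no_opposite r :
  (r <= 4)%N -> (\rank (restriction A U) <= r)%N -> U != set0 ->
  (#|U| < 2 * r)%N.
Proof.
move=> r4 rA U0; rewrite ltnNge; apply/negP=> Ur.
have U1 : (0 < #|U|)%N by rewrite card_gt0.
have [r1|r1] := leqP r 1.
  have [|T sTU cT] := @subset_of_card _ U r.+1; first by lia.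
  have [|v [dv v0 vT _]] := dependency_exists (0 : 'M[R]_(n, 0)) sTU rA.
    by rewrite cT addn0.
  have := dependency_supp_ge3 dv v0; apply/negP; rewrite -leqNgt.
  by apply: leq_trans (subset_leq_card vT) _; rewrite cT.
have [r3|r3] := leqP r 3; last first.
  have := rank4_card_lt8 (leq_trans rA r4).
  by rewrite ltnNge; apply/negP/negPn; lia.
have [|T sTU cT] := @subset_of_card _ U r.+2; first by lia.
have [|v [dv v0 vT]] := dependency_exists (const_mx 1 : 'M[R]_(n, 1)) sTU rA.
  by rewrite cT addn1.
move=> /matrixP/(_ 0 0); rewrite !mxE => sv; case/eqP: v0.
apply: (small_dependency_nosum dv).
  by apply: leq_trans (subset_leq_card vT) _; rewrite cT.
by rewrite -[RHS]sv; apply: eq_bigr => i _; rewrite mxE mulr1.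
Qed.

End NoOpposite.

(** Column [i] vanishes on the remaining rows but not on row [i], so row [i] is
    not in the span of the remaining ones. *)
Lemma rank_restriction_remove A U i j : i \in U -> A i i = 1 ->
  (forall k, k != i -> k != j -> A k i = 0) ->
  (\rank (restriction A (U :\: [set i; j])) < \rank (restriction A U))%N.
Proof.
move=> iU Aii Ai; set W := U :\: _.
have WU k : k \in W -> k \in U by move/setDP=> [].
pose D : 'M[R]_n := diag_mx (\row_k (k \in W)%:R).
have -> : restriction A W = (D *m restriction A U) *m D.
  apply/matrixP=> k l; rewrite mul_mx_diag mul_diag_mx !mxE.
  case kW: (k \in W); case lW: (l \in W) => /=; rewrite ?mul0r ?mulr0 //.
  by rewrite !WU // mul1r mulr1.
apply: leq_ltn_trans (mxrankM_maxl _ _) _; apply: rank_ltmx.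
rewrite ltmxE submxMl; apply/negP=> sub.
have /submxP[E rE] := submx_trans (row_sub i _) sub.
have := congr1 (fun M : 'rV[R]_n => M 0 i) rE; rewrite !mxE iU Aii /= => /eqP.
apply/negP; rewrite big1 ?oner_eq0 // => k _; rewrite mul_diag_mx !mxE iU andbT.
case kW: (k \in W); rewrite ?mul0r ?mulr0 // WU //.
move: kW; rewrite !inE negb_or => /andP[/andP[ki kj] _].
by rewrite Ai // !mulr0.
Qed.

(** Removing a pair of indices [i], [j] with [A i j = -1] lowers both the
    bound [r] on the rank and half the number of indices by one; once no
    such pair is left, what remains is empty by [card_no_opposite]. *)
Lemma opposite_pairs A r U :
  (forall i, A i i = 1) -> (forall i j, i != j -> -1 <= A i j <= 0) ->
  (forall i j, A i j = -1 ->
     A j i = -1 /\ forall k, k != i -> k != j -> A k i = 0) ->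
  (r <= 4)%N -> (\rank (restriction A U) <= r)%N -> (2 * r <= #|U|)%N ->
  #|U| = (2 * r)%N /\ forall i, i \in U -> exists j, A i j = -1.
Proof.
move=> Adiag Aoff Aopp.
have strict U' :
    ~~ [exists i, [exists j, [&& i \in U', j \in U' & A i j == -1]]] ->
    forall i j, i \in U' -> j \in U' -> i != j -> -1 < A i j <= 0.
  move=> none i j iU jU /Aoff; rewrite lt_neqAle eq_sym -andbA => ->.
  by rewrite andbT; move/existsPn/(_ i)/existsPn/(_ j): none; rewrite iU jU.
elim: r U => [|r IHr] U r4 rA rU;
  have [/existsP[i /existsP[j /and3P[iU jU /eqP Aij]]]|/strict none] :=
    boolP [exists i, [exists j, [&& i \in U, j \in U & A i j == -1]]].
- have := rank_restriction_remove iU (Adiag i) (Aopp i j Aij).2.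
  by move/leq_trans/(_ rA).
- have [->|U0] := eqVneq U set0.
    by rewrite cards0; split=> // i; rewrite inE.
  by have := card_no_opposite (fun i _ => Adiag i) none r4 rA U0.
- have ij : i != j.
    apply: contra_eqN Aij => /eqP <-.
    by rewrite Adiag -subr_eq0 opprK (pnatr_eq0 _ 2).
  have cW : #|U| = #|U :\: [set i; j]|.+2.
    rewrite -(cardsID [set i; j] U) (setIidPr _) ?cards2 ?ij //.
    by apply/subsetP=> k; rewrite !inE => /orP[]/eqP->.
  have [Aji Ai] := Aopp i j Aij.
  have := leq_trans (rank_restriction_remove iU (Adiag i) Ai) rA.
  rewrite ltnS => rW.
  have [|cW' pW] := IHr (U :\: [set i; j]) (ltnW r4) rW.
    by rewrite -ltnS -(ltn_add2r 1) !addn1 -cW; move: rU; clear; lia.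
  split=> [|k kU]; first by rewrite cW cW'; clear; lia.
  have [->|ki] := eqVneq k i; first by exists j.
  have [->|kj] := eqVneq k j; first by exists i.
  by apply: pW; rewrite !inE negb_or ki kj.
- have U0 : U != set0 by rewrite -card_gt0; move: rU; clear; lia.
  have := card_no_opposite (fun i _ => Adiag i) none r4 rA U0.
  by rewrite ltnNge rU.
Qed.

(** The columns of [A] stand for points and its rows for functionals.  Strict
    convexity gives the first alternative and smoothness the second; they are
    exchanged by transposition.  If column [j] is opposite to column [i], both
    have to vanish outside rows [i] and [j], since no entry there is positive;
    once every index has a partner, [A] is a direct sum of 2 x 2 blocks. *)
Lemma opposite_partner A d : (d <= 4)%N -> (\rank A <= d)%N -> (2 * d <= n)%N ->
  (forall i, A i i = 1) -> (forall i j, i != j -> -1 <= A i j <= 0) ->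
  (forall i j, A i j = -1 -> forall k, A k j = - A k i) \/
  (forall i j, A i j = -1 -> forall k, A j k = - A i k) ->
  n = (2 * d)%N /\
  forall i, exists j, [/\ A i j = -1, A j i = -1 &
    forall k, k != i -> k != j -> A i k = 0 /\ A k i = 0].
Proof.
move=> d4 rA dn Adiag Aoff Aopp.
wlog Acol : A rA Adiag Aoff Aopp /
    forall i j, A i j = -1 -> forall k, A k j = - A k i => [hw|].
  case: Aopp => [Acol|Aopp]; first by apply: hw => //; left.
  have rowE : forall i j, A^T i j = -1 -> forall k, A^T k j = - A^T k i.
    by move=> i j; rewrite mxE => /Aopp h k; rewrite !mxE h opprK.
  have [|||||nd H] := hw A^T.
  - by rewrite mxrank_tr.
  - by move=> i; rewrite mxE.
  - by move=> i j ij; rewrite mxE Aoff // eq_sym.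
  - by left.
  - exact: rowE.
  split=> // i; have [j [Aij Aji A0]] := H i; exists j.
  move: Aij Aji; rewrite !mxE; split=> // k ki kj.
  by have := A0 k ki kj; rewrite !mxE => -[].
have opp i j : A i j = -1 ->
    A j i = -1 /\ forall k, k != i -> k != j -> A k i = 0.
  move=> Aij; have Aji : A j i = -1.
    by apply: oppr_inj; rewrite -(Acol i j Aij) Adiag opprK.
  split=> // k ki kj; apply/le_anti; have /andP[_ ->] := Aoff k i ki.
  by rewrite -oppr_le0 -(Acol i j Aij); case/andP: (Aoff k j kj).
have rT : restriction A setT = A.
  by apply/matrixP=> i j; rewrite mxE !in_setT.
have [||] := @opposite_pairs A d setT Adiag Aoff opp d4.
- by rewrite rT.
- by rewrite cardsT card_ord.
rewrite cardsT card_ord => nd partner; split=> // i.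
have [j Aij] := partner i (in_setT i); have [Aji Ai] := opp i j Aij.
exists j; split=> // k ki kj; split; last exact: Ai.
have [l Akl] := partner k (in_setT k); have [Alk Ak] := opp k l Akl.
apply: Ak; first by rewrite eq_sym.
apply: contraNneq kj => il; move: Alk; rewrite -il => Aik.
have [_ Ak'] := opp i k Aik; apply: contraT => kj.
have : A j i = 0.
  apply: Ak'; last by rewrite eq_sym.
  apply: contra_eqN Aij => /eqP->.
  by rewrite Adiag -subr_eq0 opprK (pnatr_eq0 _ 2).
by rewrite Aji => /eqP; rewrite oppr_eq0 oner_eq0.
Qed.

End Dependencies.

(** * Bilinearity of the dot product *)

Section Dot.
Context {R : realType} {d : nat}.
Implicit Types (u v x y : 'rV[R]_d) (a : R).

Lemma dotE u x : dot u x = (u *m x^T) 0 0.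
Proof. by rewrite mxE; apply: eq_bigr => i _; rewrite !mxE. Qed.

Lemma dotC u x : dot u x = dot x u.
Proof. by apply: eq_bigr => i _; rewrite mulrC. Qed.

Lemma dotDr u x y : dot u (x + y) = dot u x + dot u y.
Proof. by rewrite !dotE linearD mulmxDr mxE. Qed.

Lemma dotZr u a x : dot u (a *: x) = a * dot u x.
Proof. by rewrite !dotE linearZ -scalemxAr mxE. Qed.

Lemma dotNr u x : dot u (- x) = - dot u x.
Proof. by rewrite -scaleN1r dotZr mulN1r. Qed.

Lemma dotBr u x y : dot u (x - y) = dot u x - dot u y.
Proof. by rewrite dotDr dotNr. Qed.

Lemma dotNl u x : dot (- u) x = - dot u x.
Proof. by rewrite dotC dotNr dotC. Qed.

Lemma dotDl u v x : dot (u + v) x = dot u x + dot v x.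
Proof. by rewrite dotC dotDr !(dotC x). Qed.

Lemma dotBl u v x : dot (u - v) x = dot u x - dot v x.
Proof. by rewrite dotDl dotNl. Qed.

Lemma dotZl a u x : dot (a *: u) x = a * dot u x.
Proof. by rewrite dotC dotZr dotC. Qed.

Lemma dot0r u : dot u 0 = 0.
Proof. by rewrite -(scale0r 0) dotZr mul0r. Qed.

Lemma dot_sumr (I : Type) (r : seq I) (P : pred I) (F : I -> 'rV[R]_d) u :
  dot u (\sum_(i <- r | P i) F i) = \sum_(i <- r | P i) dot u (F i).
Proof. by elim/big_rec2: _ => [|i a b _ <-]; rewrite ?dot0r ?dotDr. Qed.

End Dot.

(** * At most 2^d contacts *)

(** By Bernoulli, [(m + 1) ^ k] outgrows every multiple of [m ^ k]. *)
Lemma exp_growth_bound (n m c : nat) :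
  (0 < m)%N -> (forall k, n ^ k <= c * m ^ k)%N -> (n <= m)%N.
Proof.
move=> m0 nm; rewrite leqNgt; apply/negP => mn.
have bern k : (m ^ k.+1 + k.+1 * m ^ k <= m.+1 ^ k.+1)%N.
  elim: k => [|k IHk]; first by rewrite !expn1 expn0; lia.
  rewrite (expnS m.+1); apply: leq_trans (leq_mul (leqnn _) IHk).
  rewrite !expnS; move: (m ^ k)%N => e.
  by nia.
have : (m.+1 ^ (c * m).+1 <= c * m ^ (c * m).+1)%N.
  by apply: leq_trans (nm _); rewrite leq_exp2r.
have mk : (0 < m ^ (c * m))%N by rewrite expn_gt0 m0.
move/(leq_trans (bern _)); rewrite expnS; move: mk; move: (m ^ _)%N => e.
by clear; nia.
Qed.

Section Antipodal.
Context {R : realType} {d n : nat} (x f : 'I_n -> 'rV[R]_d).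
Hypothesis fx1 : forall i, dot (f i) (x i) = 1.
Hypothesis fx0 : forall i j, i != j -> -1 <= dot (f i) (x j) <= 0.

(** For each [k] the words of length [k] index copies of the convex hull of the
    [x i], scaled down by [2 ^ k], with disjoint interiors; [word_point]
    is the position of a copy, rescaled so that the copies have unit size. *)
Fixpoint word_point (a : seq 'I_n) : 'rV[R]_d :=
  if a is i :: a' then 2 ^+ size a' *: x i + word_point a' else 0.

Lemma word_point_spread g D a b :
  (forall i j, dot g (x i) - dot g (x j) <= D) -> size a = size b ->
  dot g (word_point a) - dot g (word_point b) <= (2 ^+ size a - 1) * D.
Proof.
move=> gD; elim: a b => [|i a IHa] [|j b] //= => [_|[ab]].
  by rewrite expr0 !subrr mul0r.
rewrite !dotDr !dotZr -ab exprS.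
have := IHa b ab; have := gD i j.
have : 0 <= 2 ^+ size a :> R by rewrite exprn_ge0.
move: (2 ^+ size a) => p p0 h1 h2.
have : p * (dot g (x i) - dot g (x j)) <= p * D by rewrite ler_wpM2l.
by lra.
Qed.

(** If the words first differ at letters [i] and [j], then [f i - f j] separates
    the points: it takes its largest value among the [x k] at [x i] and its
    smallest at [x j], so that the later letters, whose weights sum to one
    less than that of the first difference, cannot compensate. *)
Lemma word_point_separated a b : size a = size b -> a != b ->
  exists i j, 1 <= dot (f i - f j) (word_point a - word_point b).
Proof.
elim: a b => [|i a IHa] [|j b] //= => [[ab]].
rewrite eqseq_cons -ab; have [<- /= /(IHa b ab)[k [l kl]]|ij _] := eqVneq i j.
  by exists k, l; rewrite opprD addrACA subrr add0r.
exists i, j; set g := f i - f j.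
have gE k : dot g (x k) = dot (f i) (x k) - dot (f j) (x k) by rewrite dotBl.
have gi : 1 <= dot g (x i).
  have ji : j != i by rewrite eq_sym.
  by rewrite gE fx1; case/andP: (fx0 ji) => _; lra.
have gj : dot g (x j) <= -1.
  by rewrite gE fx1; case/andP: (fx0 ij) => _; lra.
have gk k : dot g (x j) <= dot g (x k) <= dot g (x i).
  have [->|ki] := eqVneq k i; first by rewrite lexx andbT; lra.
  have [->|kj] := eqVneq k j; first by rewrite lexx /=; lra.
  rewrite eq_sym in ki; rewrite eq_sym in kj.
  by have /andP[? ?] := fx0 ki; have /andP[? ?] := fx0 kj; rewrite (gE k); lra.
have gD k l : dot g (x k) - dot g (x l) <= dot g (x i) - dot g (x j).
  by have /andP[? ?] := gk k; have /andP[? ?] := gk l; lra.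
have := word_point_spread gD (esym ab); rewrite -ab.
rewrite dotBr !dotDr !dotZr.
move: (2 ^+ size a) => p; lra.
Qed.

Lemma word_point_bound B a l : (forall i, `|x i 0 l| <= B) ->
  `|word_point a 0 l| <= B * (2 ^+ size a - 1).
Proof.
move=> xB; elim: a => [|i a IHa] /=.
  by rewrite mxE normr0 expr0 subrr mulr0.
rewrite !mxE (le_trans (ler_normD _ _)) // normrM ger0_norm ?exprn_ge0 //.
have : 2 ^+ size a * `|x i 0 l| <= 2 ^+ size a * B.
  by rewrite ler_wpM2l ?exprn_ge0.
by rewrite exprS; move: IHa; lra.
Qed.

(** A modulus of continuity for all the functionals [f i - f j] at once. *)
Lemma dot_small (q : R) (i j : 'I_n) (y : 'rV[R]_d) :
  2 * (\sum_i \sum_l `|f i 0 l|) < q -> (forall l, `|y 0 l| * q <= 1) ->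
  dot (f i - f j) y < 1.
Proof.
set L := \sum_i _ => Lq yq.
have L0 k : 0 <= \sum_l `|f k 0 l| by apply: sumr_ge0.
have q0 : 0 < q by apply: le_lt_trans Lq; rewrite mulr_ge0 ?sumr_ge0.
have fL k : `|dot (f k) y| <= L / q.
  apply: (@le_trans _ _ (\sum_l `|f k 0 l| / q)).
    apply: (le_trans (ler_norm_sum _ _ _)); apply: ler_sum => l _.
    by rewrite normrM ler_wpM2l // -[q^-1]mul1r ler_pdivlMr.
  rewrite -mulr_suml ler_wpM2r ?invr_ge0 ?(ltW q0) // /L (bigD1 k) //= lerDl.
  by apply: sumr_ge0 => ? _.
have : L / q + L / q < 1 by rewrite -mulrDl ltr_pdivrMr // mul1r; lra.
have := fL i; have := fL j; rewrite dotBl !ler_norml => /andP[? ?] /andP[? ?].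
lra.
Qed.

(** The [n ^ k] word points are separated by a distance that does not depend on
    [k], and they lie in a cube of side [O(2 ^ k)].  Distinct points thus lie in
    distinct cells of a fixed grid, of which the cube has [O((2 ^ d) ^ k)].
    This is the Danzer-Gruenbaum packing argument with volumes replaced by a
    count of cells. *)
Lemma card_le_pow2 : (n <= 2 ^ d)%N.
Proof.
pose B : R := \sum_i \sum_l `|x i 0 l|.
pose q : R := 2 * (\sum_i \sum_l `|f i 0 l|) + 1.
have q0 : 0 < q.
  by rewrite ltr_pwDr // mulr_ge0 ?sumr_ge0 // => i _; apply: sumr_ge0.
have xB i l : `|x i 0 l| <= B.
  rewrite /B (bigD1 i) //= (bigD1 l) //= -addrA lerDl addr_ge0 //.
    by apply: sumr_ge0.
  by apply: sumr_ge0 => ? _; apply: sumr_ge0.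
have B0 : 0 <= B by apply: sumr_ge0 => ? _; apply: sumr_ge0.
pose C := (Num.trunc (2 * B * q)).+1.
apply: (@exp_growth_bound _ _ (C ^ d)); first by rewrite expn_gt0.
move=> k.
(* shifted to be nonnegative, and rescaled so that the grid has unit side *)
pose cell (a : k.-tuple 'I_n) l := (word_point a 0 l + B * 2 ^+ k) * q.
have cellP a l : 0 <= cell a l < (C * 2 ^ k)%N%:R.
  have := word_point_bound a (xB ^~ l).
  rewrite size_tuple ler_norml => /andP[w1 w2]; apply/andP; split.
    by rewrite mulr_ge0 ?(ltW q0) //; lra.
  have BC : 2 * B * q < C%:R.
    by have /andP[] := truncn_itv (mulr_ge0 (mulr_ge0 (ler0n R 2) B0) (ltW q0)).
  apply: (@le_lt_trans _ _ (2 * B * q * 2 ^+ k)).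
    rewrite [leRHS](_ : _ = 2 * B * 2 ^+ k * q); last by ring.
    by rewrite ler_wpM2r ?(ltW q0) //; lra.
  by rewrite natrM natrX ltr_pM2r // exprn_gt0.
have cell_lt a l : (Num.trunc (cell a l) < C * 2 ^ k)%N.
  by have /andP[c0 c1] := cellP a l; rewrite truncn_lt_nat.
pose code a : {ffun 'I_d -> 'I_(C * 2 ^ k)} :=
  [ffun l => Ordinal (cell_lt a l)].
have code_inj : injective code.
  move=> a b ab; apply/val_inj/eqP; apply: contraT => /= neq_ab.
  have [|i [j]] := word_point_separated _ neq_ab; first by rewrite !size_tuple.
  rewrite leNgt => /negP[]; apply: (dot_small (q := q)) => [|l].
    by rewrite /q ltrDl.
  have /(congr1 val) /= := congr1 (fun c : {ffun 'I_d -> _} => c l) ab.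
  rewrite !ffunE /= => cab.
  have /andP[ca _] := cellP a l; have /andP[cb _] := cellP b l.
  have /andP[a1 a2] := truncn_itv ca; have /andP[b1 b2] := truncn_itv cb.
  rewrite -(ger0_norm (ltW q0)) -normrM !mxE mulrBl.
  have -> : word_point a 0 l * q - word_point b 0 l * q = cell a l - cell b l.
    by rewrite /cell; ring.
  move: a1 a2 b1 b2; rewrite cab -natr1 ler_norml; lra.
have := leq_card code code_inj.
by rewrite card_tuple card_ffun !card_ord expnMn -!expnM [(k * d)%N]mulnC.
Qed.

End Antipodal.

Local Open Scope classical_set_scope.
Local Open Scope ring_scope.

(** * Contact points and their normals *)

Section Bodies.
Context {R : realType} {d : nat}.
Implicit Types (K A : set 'rV[R]_d) (u f g x y z : 'rV[R]_d) (c t : R).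

Lemma dot_gt0 u : u != 0 -> 0 < dot u u.
Proof.
move=> u0; rewrite lt_neqAle sumr_ge0 ?andbT => [|i _]; last exact: sqr_ge0.
apply: contraNneq u0 => u0; apply/eqP/rowP=> i; rewrite mxE.
apply/eqP; rewrite -[_ == 0]sqrf_eq0; apply/eqP.
by apply: (psumr_eq0P _ (esym u0)) => // j _; exact: sqr_ge0.
Qed.

Lemma dot_inj f g : (forall x, dot f x = dot g x) -> f = g.
Proof.
move=> fg; apply/eqP; rewrite -subr_eq0; apply: contraT => /dot_gt0.
by rewrite dotBl fg subrr ltxx.
Qed.

Lemma interior_normP A x :
  A° x <-> exists2 e : R, 0 < e & forall z, `|z| < e -> A (x + z).
Proof.
rewrite /interior; split=> [/nbhs_ballP[e /= e0 eA]|[e e0 eA]].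
  exists e => // z ze; apply: eA; rewrite -ball_normE /=.
  by rewrite opprD addrA subrr sub0r normrN.
apply/nbhs_ballP; exists e => //= y; rewrite -ball_normE /= => xy.
by rewrite -[y](subrK x) addrC; apply: eA; rewrite distrC.
Qed.

Lemma convex_comb A x y t : convex_set A -> 0 <= t -> t <= 1 ->
  A x -> A y -> A (t *: x + (1 - t) *: y).
Proof.
move=> cA t0 t1 Ax Ay.
by have := cA x y (Itv01 t0 t1); rewrite !inE; exact.
Qed.

Lemma halfspace_interior A u c x : u != 0 ->
  (forall y, A y -> dot u y <= c) -> A° x -> dot u x < c.
Proof.
move=> u0 Ac /interior_normP[e e0 eA].
pose t := e / 2 / (`|u| + 1).
have un : 0 < `|u| + 1 by rewrite ltr_wpDl.
have t0 : 0 < t by rewrite !divr_gt0.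
have : A (x + t *: u).
  apply: eA; rewrite normrZ gtr0_norm // /t mulrAC ltr_pdivrMr //.
  by have := mulr_ge0 (ltW e0) (normr_ge0 u); lra.
move/Ac; rewrite dotDr dotZr; apply: lt_le_trans.
by rewrite ltrDl mulr_gt0 // dot_gt0.
Qed.

Lemma translate_interior A x y : A° y -> (translate x A)° (x + y).
Proof.
move/interior_normP=> [e e0 eA]; apply/interior_normP; exists e => // z ze.
by exists (y + z); rewrite ?addrA //; exact: eA.
Qed.

(** Outer normals are scaled to lie on the boundary of the polar body; this
    makes points and normals play dual roles. *)
Definition contact K x f : Prop :=
  [/\ K x, dot f x = 1 & forall y, K y -> dot f y <= 1].

Lemma contact_neq0 K x f : contact K x f -> f != 0.
Proof.
case=> _ fx _; apply: contra_eqN fx => /eqP->.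
by rewrite dotC dot0r eq_sym oner_eq0.
Qed.

Lemma contact_boundary K x f : contact K x f -> boundary K x.
Proof.
move=> cf; have f0 := contact_neq0 cf; case: cf => Kx fx fK.
split; first exact: subset_closure.
by move=> /(halfspace_interior f0 fK); rewrite fx ltxx.
Qed.

Lemma contact_supporting K x f :
  contact K x f -> supporting_hyperplane K (hyperplane f 1).
Proof.
move=> cf; exists f, 1; split=> //; first exact: contact_neq0 cf.
  by case: cf.
by exists x; case: cf.
Qed.

Lemma hyperplane1_inj f g x :
  dot f x = 1 -> hyperplane f 1 = hyperplane g 1 -> f = g.
Proof.
move=> fx fg; apply: dot_inj => w.
have on y : dot f y = 1 -> dot g y = 1.
  by move=> fy; have : hyperplane f 1 y by []; rewrite fg.
have gx := on _ fx.
have /on : dot f (x + (w - dot f w *: x)) = 1.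
  by rewrite dotDr dotBr dotZr fx mulr1 subrr addr0.
by rewrite dotDr dotBr dotZr gx mulr1; lra.
Qed.

Lemma smooth_contact_inj K x f g :
  smooth K -> contact K x f -> contact K x g -> f = g.
Proof.
move=> sK cf cg; have [_ fx _] := cf; have [_ gx _] := cg.
have [H [_ Huniq]] := sK x (contact_boundary cf).
apply: (hyperplane1_inj fx).
rewrite -(Huniq (hyperplane f 1)) ?(Huniq (hyperplane g 1)) //.
  by split=> //; exact: contact_supporting cg.
by split=> //; exact: contact_supporting cf.
Qed.

(** The segment between two contact points of one support plane lies in the
    boundary. *)
Lemma strictly_convex_contact_inj K x y f :
  convex_set K -> strictly_convex K -> contact K x f -> contact K y f -> x = y.
Proof.
move=> cK sK [Kx fx fK] [Ky fy _]; apply: sK => _ [t /= /itvP tI <-].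
apply: (@contact_boundary _ _ f); split=> //; last first.
  by rewrite dotDr !dotZr fx fy; ring.
have := @convex_comb K x y (1 - t) cK; rewrite subKr; apply=> //.
  by rewrite subr_ge0 tI.
by rewrite gerBl tI.
Qed.

Section Symmetric.
Variable K : set 'rV[R]_d.
Hypothesis K_body : convex_body K.
Hypothesis K_sym : o_symmetric K.

Lemma symN x : K x -> K (- x).
Proof. by move=> Kx; rewrite K_sym; exists x. Qed.

Lemma half_diff x y : K x -> K y -> K (2^-1 *: (x - y)).
Proof.
case: K_body => _ cK _ Kx /symN Ky.
have := @convex_comb K x (- y) 2^-1 cK; rewrite scalerDr.
by rewrite [1 - _](_ : _ = 2^-1); [apply=> //; lra|lra].
Qed.

(** A ball in [K] and its reflection in [o] average to a ball around [o]. *)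
Lemma origin_interior : K° 0.
Proof.
case: K_body => _ _ [p /interior_normP[e e0 eK]].
apply/interior_normP; exists e => // z ze.
have -> : 0 + z = 2^-1 *: ((p + z) - (p - z)).
  rewrite opprB [X in _ *: X]addrC addrA subrK -mulr2n -[z *+ 2]scaler_nat.
  by rewrite scalerA mulVf ?scale1r ?add0r // pnatr_eq0.
by apply: half_diff; apply: eK; rewrite ?normrN.
Qed.

Lemma scale_interior x t : K x -> `|t| < 1 -> K° (t *: x).
Proof.
wlog t0 : x t / 0 <= t => [hw Kx t1|Kx].
  have [/hw|t0] := leP 0 t; first exact.
  have -> : t *: x = (- t) *: (- x) by rewrite scaleNr scalerN opprK.
  apply: hw; rewrite ?normrN ?oppr_ge0 ?ltW //.
  exact: symN.
rewrite ger0_norm // => t1; have /interior_normP[e e0 eK] := origin_interior.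
have s0 : 0 < 1 - t by lra.
apply/interior_normP; exists ((1 - t) * e) => [|z ze].
  by rewrite mulr_gt0.
have -> : z = (1 - t) *: ((1 - t)^-1 *: z).
  by rewrite scalerA divff ?scale1r // gt_eqF.
case: K_body => _ cK _; apply: convex_comb => //; first exact: ltW.
rewrite -[_ *: z]add0r; apply: eK.
by rewrite normrZ gtr0_norm ?invr_gt0 // ltr_pdivrMl.
Qed.

Lemma contact_ge x f y : contact K x f -> K y -> -1 <= dot f y.
Proof. by case=> _ _ fK /symN /fK; rewrite dotNr; lra. Qed.

(** A plane separating two touching bodies supports both at every common point.
    Applied to a common point and its mirror image in the midpoint [x] of the
    two centres, this puts [x] on the plane. *)
Lemma touching_contact x u c : u != 0 ->
  (forall y, K y -> dot u y <= c) ->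
  (forall y, translate (2 *: x) K y -> c <= dot u y) ->
  translate (2 *: x) K `&` K !=set0 ->
  0 < c /\ contact K x (c^-1 *: u).
Proof.
move=> u0 uK ux [z [zx Kz]].
have c0 : 0 < c.
  by have := halfspace_interior u0 uK origin_interior; rewrite dot0r.
have Kx : K x.
  case: zx => k Kk zE; have := half_diff Kz Kk.
  by rewrite -zE addrK scalerA mulVf ?scale1r // pnatr_eq0.
have uz : dot u z = c by apply/le_anti; rewrite uK // ux.
split=> //; split=> // [|y Ky]; last first.
  by rewrite dotZl ler_pdivrMl // mulr1 uK.
have : c <= dot u (2 *: x - z).
  by apply: ux; exists (- z); rewrite //; exact: symN.
have := uK x Kx; rewrite dotBr dotZr uz dotZl => h1 h2.
have -> : dot u x = c by lra.
by rewrite mulVf // gt_eqF.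
Qed.

(** For [0 < dot f y < 1] the plane would cut the diameter of the translate that
    is parallel to [x] at an interior point. *)
Lemma avoiding_contact x f y : contact K x f -> K y ->
  hyperplane f 1 `&` (translate (2 *: y) K)° = set0 ->
  dot f y <= 0 \/ dot f y = 1.
Proof.
move=> [Kx fx fK] Ky; have [|f0 avoid] := leP (dot f y) 0; first by left.
right; apply/le_anti; rewrite fK //= leNgt; apply/negP=> f1.
pose t := 1 - 2 * dot f y.
suff : (hyperplane f 1 `&` (translate (2 *: y) K)°) (2 *: y + t *: x).
  by rewrite avoid.
split; first by rewrite /hyperplane /= dotDr !dotZr fx /t; lra.
apply: translate_interior; apply: scale_interior => //.
by rewrite ltr_norml /t; apply/andP; split; lra.
Qed.

(** Otherwise the segment from [o] to [y] would cross the plane inside [K]. *)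
Lemma avoiding_side u c : 0 <= c -> hyperplane u c `&` K° = set0 ->
  forall y, K y -> dot u y <= c.
Proof.
move=> c0 avoid y Ky; rewrite leNgt; apply/negP=> uy.
have uy0 : 0 < dot u y by apply: le_lt_trans uy.
suff : (hyperplane u c `&` K°) ((c / dot u y) *: y) by rewrite avoid.
split; first by rewrite /hyperplane /= dotZr divfK // gt_eqF.
apply: scale_interior => //.
have q0 : 0 <= c / dot u y by rewrite divr_ge0 // ltW.
by rewrite ger0_norm // ltr_pdivrMr // mul1r.
Qed.

(** * Configurations and systems of contact normals *)

Section Contacts.
Variables (I : Type) (x : I -> 'rV[R]_d).
Let F i := translate (2 *: x i) K.

(** The plane separating the [i]-th member from [K] supports [K] at [x i] and
    yields [f i].  As it avoids the interiors of the other members,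
    [avoiding_contact] leaves only [dot (f i) (x j) = 1] to be excluded, where
    [x i] and [x j] have a common support plane.  If [K] is strictly
    convex, this makes the two members equal.  If [K] is smooth, this makes
    the normals equal, and then every plane that separates the two members
    meets the interior of [K]. *)
Lemma configuration_contacts :
  smooth K \/ strictly_convex K -> separable_Hadwiger_configuration K F ->
  exists f : I -> 'rV[R]_d, (forall i, contact K (x i) (f i)) /\
    forall i j, i <> j -> -1 <= dot (f i) (x j) <= 0.
Proof.
move=> K_reg [touch [[_ triv] sep]]; have [_ cK _] := K_body.
have /choice[f /all_and2[cf avoid]] : forall i, exists f : 'rV[R]_d,
    contact K (x i) f /\ forall k, hyperplane f 1 `&` (F k)° = set0.
  move=> i.
  have [//|H [[u [c [u0 HE uK ux]]] avoid]] := sep None (Some i).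
  have [c0 cf] := touching_contact u0 uK ux (touch i).
  exists (c^-1 *: u); split=> // k; rewrite -(avoid (Some k)) HE.
  congr (_ `&` _); apply/seteqP; split=> y; rewrite /hyperplane /= dotZl.
    by move/(congr1 ( *%R c)); rewrite mulVKf ?gt_eqF // mulr1.
  by move->; rewrite mulVf // gt_eqF.
exists f; split=> // i j ij; have [Kj fj _] := cf j.
rewrite (contact_ge (cf i)) //=.
have [//|fij] := avoiding_contact (cf i) Kj (avoid i j).
have cij : contact K (x j) (f i) by split=> //; case: (cf i).
exfalso; case: K_reg => [sK|sK]; last first.
  have xij := strictly_convex_contact_inj cK sK (cf i) cij.
  have Fi : (F i)° (2 *: x i + 0).
    by apply: translate_interior; exact: origin_interior.
  have : Some i = Some j.
    apply: triv => //; exists (2 *: x i + 0).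
    by split; rewrite //= /F -xij.
  by case.
have fE : f i = f j := smooth_contact_inj sK cij (cf j).
(* A plane between the two members that avoids the interior of [K] has [K] on
   the side of one of them, so it separates [K] from the other, the [l]-th; it
   is then the support plane at [x l], and by [f k = f l] it has the point
   [3 *: x k] of the [k]-th member on the wrong side. *)
have no_side u c k l : u != 0 -> f k = f l -> 0 <= c ->
    hyperplane u c `&` K° = set0 ->
    (forall y, F k y -> dot u y <= c) ->
    (forall y, F l y -> c <= dot u y) -> False.
  move=> u0 fkl c0 uavoid uk ul.
  have uK := avoiding_side c0 uavoid.
  have [{}c0 cl] := touching_contact u0 uK ul (touch l).
  have := smooth_contact_inj sK cl (cf l); rewrite -fkl => uf.
  have [Kk fk _] := cf k.
  have : dot u (2 *: x k + x k) <= c by apply: uk; exists (x k).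
  have uxk : dot u (x k) = c.
    move: fk; rewrite -uf dotZl => /(congr1 ( *%R c)).
    by rewrite mulVKf ?gt_eqF // mulr1.
  by rewrite dotDr dotZr uxk; lra.
have [|H [[u [c [u0 HE ui uj]]] uavoid]] := sep (Some i) (Some j).
  by case.
have {uavoid} := uavoid None; rewrite HE /= => uavoid.
have [c0|c0] := leP 0 c; first exact: (no_side u c i j).
apply: (no_side (- u) (- c) j i) => //.
- by rewrite oppr_eq0.
- by rewrite oppr_ge0 ltW.
- rewrite -uavoid; congr (_ `&` _); apply/seteqP; split=> y;
    rewrite /hyperplane /= dotNl; first exact: oppr_inj.
  by move->.
- by move=> y /uj; rewrite dotNl lerN2.
- by move=> y /ui; rewrite dotNl lerN2.
Qed.

(** [- x j] is another contact point of the support plane [f i]; its own normal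
    is [- f j]. *)
Lemma contacts_opposite (f : I -> 'rV[R]_d) :
  smooth K \/ strictly_convex K -> (forall i, contact K (x i) (f i)) ->
  (forall i j, dot (f i) (x j) = -1 -> x j = - x i) \/
  (forall i j, dot (f i) (x j) = -1 -> f j = - f i).
Proof.
move=> K_reg cf; have [_ cK _] := K_body.
have opp i j : dot (f i) (x j) = -1 -> contact K (- x j) (f i).
  move=> fij; have [_ _ fK] := cf i; have [Kj _ _] := cf j.
  by split=> //; [exact: symN|rewrite dotNr fij opprK].
case: K_reg => [sK|sK]; [right|left] => i j fij; have cij := opp i j fij.
  have cj : contact K (- x j) (- f j).
    have [Kj fj fK] := cf j; split=> [||y /symN /fK]; first exact: symN.
      by rewrite dotNr dotNl opprK.
    by rewrite dotNr dotNl.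
  by rewrite (smooth_contact_inj sK cij cj) opprK.
by rewrite (strictly_convex_contact_inj cK sK (cf i) cij) opprK.
Qed.

(** The plane [dot (f i) y = 1] has the [i]-th member on one side and [K]
    and all other members on the other. *)
Lemma contacts_configuration (f : I -> 'rV[R]_d) :
  (forall i, contact K (x i) (f i)) ->
  (forall i j, i <> j -> dot (f i) (x j) <= 0) ->
  separable_Hadwiger_configuration K F.
Proof.
move=> cf f0; pose G := fun o : option I => oapp F K o.
have above i y : F i y -> 1 <= dot (f i) y.
  move=> [k Kk <-]; have [_ fi _] := cf i.
  by rewrite dotDr dotZr fi; have := contact_ge (cf i) Kk; lra.
have below i o y : o <> Some i -> G o y -> dot (f i) y <= 1.
  have [_ _ fK] := cf i; case: o => [j|] oi /=; last exact: fK.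
  case=> k Kk <-; rewrite dotDr dotZr.
  have ij : i <> j by move=> ij; apply: oi; rewrite ij.
  by have := f0 i j ij; have := fK k Kk; lra.
have above' i y : (F i)° y -> 1 < dot (f i) y.
  have u0 : - f i != 0 by rewrite oppr_eq0; exact: contact_neq0 (cf i).
  move/(halfspace_interior u0 (c := -1)).
  by rewrite dotNl ltrN2; apply=> z /above; rewrite dotNl lerN2.
have below' i o y : o <> Some i -> (G o)° y -> dot (f i) y < 1.
  move=> oi; apply: halfspace_interior; first exact: contact_neq0 (cf i).
  by move=> z; exact: below.
split; [|split; [split|]].
- move=> i; exists (x i); have [Ki _ _] := cf i; split=> //.
  exists (- x i); first exact: symN.
  by rewrite scaler_nat mulr2n addrK.
- case=> [i|] /=; first by exists (2 *: x i).
  exists 0; apply/seteqP; split=> [y Ky|_ [y Ky <-]]; last by rewrite add0r.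
  by exists y => //; rewrite add0r.
- have disj i o : o <> Some i -> (F i)° `&` (G o)° !=set0 -> False.
    move=> oi [y [/above' yi /(below' _ _ _ oi) yo]].
    by move: (lt_trans yi yo); rewrite ltxx.
  case=> [i|] o _ _ meet; apply: contrapT => ne.
    by apply: (@disj i o) => // oi; apply: ne.
  case: o ne meet => // j ne [y [y1 y2]].
  by apply: (@disj j None) => //; exists y.
have avoid i k : hyperplane (f i) 1 `&` (G k)° = set0.
  apply/seteqP; split=> // y [/= fy]; have [->|ki] := pselect (k = Some i).
    by move/above'; rewrite fy ltxx.
  by move/(below' _ _ _ ki); rewrite fy ltxx.
case=> [i|] o ne.
  exists (hyperplane (f i) 1); split; last exact: avoid.
  exists (- f i), (-1); split=> [||y /above|y].
  - by rewrite oppr_eq0; exact: contact_neq0 (cf i).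
  - apply/seteqP; split=> y; rewrite /hyperplane /= dotNl; first by move->.
    exact: oppr_inj.
  - by rewrite dotNl lerN2.
  - by move=> /(below i _ _ (nesym ne)); rewrite dotNl lerN2.
case: o ne => // j ne.
exists (hyperplane (f j) 1); split; last exact: avoid.
exists (f j), 1; split=> // [|y|y /above //]; first exact: contact_neq0 (cf j).
by move=> Ky; apply: (below j None).
Qed.

End Contacts.

End Symmetric.
End Bodies.

(** * Auerbach bases *)

Section Auerbach.
Context {R : realType} {d : nat}.
Implicit Types (K : set 'rV[R]_d) (b f : 'I_d -> 'rV[R]_d).

(** A left inverse of a square matrix is a right inverse. *)
Lemma dual_expansion b f : (forall i j, dot (f i) (b j) = (i == j)%:R) ->
  forall y, y = \sum_j dot (f j) y *: b j.
Proof.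
move=> fb y.
pose B : 'M[R]_d := \matrix_i b i; pose G : 'M[R]_d := \matrix_i f i.
have /mulmx1C GB : B *m G^T = 1%:M.
  apply/matrixP=> i j; rewrite !mxE eq_sym -fb.
  by apply: eq_bigr => k _; rewrite !mxE mulrC.
rewrite -[LHS]mulmx1 -GB mulmxA; apply/rowP=> l; rewrite mxE summxE.
apply: eq_bigr => j _; rewrite [in RHS]mxE [B _ _]mxE; congr (_ * _).
by rewrite mxE; apply: eq_bigr => k _; rewrite !mxE mulrC.
Qed.

Lemma contact_Auerbach K b f : (forall i, contact K (b i) (f i)) ->
  (forall i j, dot (f i) (b j) = (i == j)%:R) -> Auerbach_basis K b.
Proof.
move=> cf fb; have expand := dual_expansion fb.
split=> [i|| i]; first exact: contact_boundary (cf i).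
  rewrite basisEdim size_image card_ord dimvf /dim /= mul1n leqnn andbT.
  apply/subvP=> y _; rewrite [y]expand; apply: rpred_sum => j _.
  by apply: rpredZ; apply: memv_span; apply: map_f; rewrite mem_enum.
rewrite [X in supporting_hyperplane _ X](_ : _ = hyperplane (f i) 1).
  exact: contact_supporting.
apply/seteqP; split=> [_ [a _ <-]|y /= fy].
  rewrite /hyperplane /= dotDr fb eqxx dot_sumr big1 ?addr0 // => j ji.
  by rewrite dotZr fb eq_sym (negPf ji) mulr0.
exists (fun j => dot (f j) y) => //.
by rewrite [RHS]expand [RHS](bigD1 i) //= fy scale1r.
Qed.

Lemma continuous_det : continuous
  (fun b : prod_topology (fun _ : 'I_d => 'rV[R]_d) => \det (\matrix_i b i) : R).
Proof.
set T := prod_topology _.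
have coord i j : continuous (fun b : T => (\matrix_k b k) i j : R).
  rewrite (_ : (fun b => _) = fun b : T => b i 0 j); last first.
    by apply/funext=> b; rewrite mxE.
  move=> b.
  have pc : continuous (proj i : T -> 'rV[R]_d) by exact: proj_continuous.
  exact: (@continuous_comp T 'rV[R]_d R (proj i) (fun y => y 0 j) b (pc b)
    (@coord_continuous _ _ _ _ _ _)).
apply: continuous_big => [|s _ b]; first exact: add_continuous.
have monom : continuous (fun b : T => \prod_i (\matrix_k b k) i (s i) : R).
  by apply: continuous_big => [|i _]; [exact: mul_continuous|exact: coord].
by apply: cvgMl_tmp; [exact: nbhs_filter|exact: monom].
Qed.

(** Among all choices of [d] points of [K], take one with the largest
    determinant. Replacing the [i]-th point by [y] multiplies the
    determinant by a linear function of [y], given by cofactors, which by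
    maximality is at most 1 on [K]: it is the normal at the [i]-th point and
    vanishes at the others. *)
Lemma Auerbach_exists K : convex_body K -> o_symmetric K ->
  exists b f : 'I_d -> 'rV[R]_d, (forall i, contact K (b i) (f i)) /\
    forall i j, dot (f i) (b j) = (i == j)%:R.
Proof.
move=> K_body K_sym; pose A := [set b : 'I_d -> 'rV[R]_d | forall i, K (b i)].
have cA : compact (A : set (prod_topology (fun _ : 'I_d => 'rV[R]_d))).
  by apply: (@tychonoff _ _ (fun=> K)) => _; case: K_body.
have /interior_normP[e e0 eK] := origin_interior K_body K_sym.
have [M0 AM0 D0] : exists2 b : 'I_d -> 'rV[R]_d, A b & 0 < \det (\matrix_i b i).
  exists (fun i => (e / 2) *: delta_mx 0 i) => [i|].
    rewrite /A /= -[_ *: _]add0r; apply: eK.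
    apply: (@le_lt_trans _ _ (e / 2)); last by lra.
    have e2 : 0 < e / 2 by rewrite divr_gt0.
    rewrite normrZ gtr0_norm // ler_piMr ?(ltW e2) //.
    rewrite [leLHS]mx_normrE; apply/bigmax_leP; split=> // k _; rewrite !mxE.
    by case: (_ && _); rewrite ?normr0 ?normr1.
  rewrite (_ : \matrix_i _ = (e / 2)%:M) ?det_scalar ?exprn_gt0 ?divr_gt0 //.
  apply/matrixP=> i j; rewrite !mxE eqxx /= eq_sym.
  by case: (i == j); rewrite ?mulr1 ?mulr0.
have [c] := @compact_EVT_max (prod_topology (fun _ : 'I_d => 'rV[R]_d)) R _ A
  (ex_intro _ M0 AM0) cA (continuous_subspaceT continuous_det).
rewrite inE => Ac cmax; pose M := \matrix_i c i; pose D := \det M.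
have Dgt0 : 0 < D by apply: lt_le_trans D0 (cmax _ _); rewrite inE.
pose f i : 'rV[R]_d := \row_k (cofactor M i k / D).
have fE i y : dot (f i) y = (\sum_k y 0 k * cofactor M i k) / D.
  by rewrite mulr_suml; apply: eq_bigr => k _; rewrite mxE; ring.
have fc i j : dot (f i) (c j) = (i == j)%:R.
  have := congr1 (fun N : 'M[R]_d => N j i) (mul_mx_adj M).
  rewrite fE !mxE => cof.
  have -> : \sum_k c j 0 k * cofactor M i k = \sum_k M j k * (\adj M) k i.
    by apply: eq_bigr => k _; rewrite [M j k]mxE [(\adj M) k i]mxE.
  rewrite cof eq_sym; case: (i == j); rewrite ?mulr0n ?mul0r //.
  by rewrite mulr1n divff // gt_eqF.
exists c, f; split=> // i; split=> [||y Ky]; [exact: Ac|by rewrite fc eqxx|].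
pose N := \matrix_k (if k == i then y else c k).
rewrite fE ler_pdivrMr // mul1r.
(* expanding [N] along row [i], where its cofactors are those of [M] *)
rewrite (_ : \sum_k _ = \det N); last first.
  rewrite (expand_det_row N i); apply: eq_bigr => k _.
  rewrite [N i k]mxE eqxx; congr (_ * (_ * \det _)).
  apply/matrixP=> r s; rewrite !mxE.
  by rewrite eq_sym (negPf (neq_lift i r)).
apply: cmax; rewrite inE => k.
by case: (k == i) => //; exact: Ac.
Qed.


End Auerbach.

(** * The separable Hadwiger number *)

Section Configurations.
Context {R : realType} {d : nat}.
Variable K : set 'rV[R]_d.
Local Open Scope card_scope.

Lemma card_le_or_inj (I : Type) n :
  [set: I] #<= `I_n \/ exists h : 'I_n.+1 -> I, injective h.
Proof.
have big : `I_n.+1 #<= [set: I] -> exists h : 'I_n.+1 -> I, injective h.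
  move=> /card_leP[f]; exists (set_val \o f \o ordII).
  apply: inj_comp (can_inj ordIIK); apply: inj_comp; first exact: val_inj.
  by move=> i j; apply: inj; rewrite inE.
have [|/infiniteP infI] := pselect (finite_set [set: I]); last first.
  by right; apply: big; apply: card_le_trans infI; exact: subset_card_le.
case=> m Im; have [mn|nm] := leqP m n; [left|right; apply: big].
  by rewrite (card_le_eql Im) card_le_II.
by rewrite (card_le_eqr Im) card_le_II.
Qed.

Lemma configuration_sub (I J : Type) (F : I -> set 'rV[R]_d) (h : J -> I) :
  injective h -> separable_Hadwiger_configuration K F ->
  separable_Hadwiger_configuration K (F \o h).
Proof.
move=> hinj [touch [[tr triv] sep]].
have oE o : oapp (F \o h) K o = oapp F K (omap h o) by case: o.
have oinj : injective (omap h).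
  by case=> [i|] [j|] //= [] /hinj ->.
split=> [i|]; first exact: touch.
split; [split=> [k|k l _ _ meet]|move=> k l ne].
- by rewrite oE.
- by apply/oinj/triv => //; move: meet; rewrite !oE.
have [|H [sepH avoid]] := sep (omap h k) (omap h l); first by move/oinj.
by exists H; rewrite !oE; split=> // m; rewrite oE.
Qed.

Lemma configuration_translates (I : Type) (F : I -> set 'rV[R]_d) :
  separable_Hadwiger_configuration K F ->
  exists x : I -> 'rV[R]_d, F = fun i => translate (2 *: x i) K.
Proof.
move=> [_ [[tr _] _]].
have /choice[y yF] : forall i, exists y, F i = translate y K.
  by move=> i; exact: (tr (Some i)).
exists (fun i => 2^-1 *: y i); apply/funext=> i.
by rewrite scalerA divff ?scale1r // pnatr_eq0.
Qed.

(** It suffices to bound finite configurations, since a family with more than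
    [n] members has a subfamily with exactly [n + 1]. *)
Lemma separable_Hadwiger_number_max n :
  (exists F : 'I_n -> set 'rV[R]_d, separable_Hadwiger_configuration K F) ->
  (forall m (F : 'I_m -> set 'rV[R]_d),
     separable_Hadwiger_configuration K F -> (m <= n)%N) ->
  separable_Hadwiger_number K n.
Proof.
move=> ex max; split=> // I F cF.
have [//|[h hinj]] := card_le_or_inj I n.
by have := max _ _ (configuration_sub hinj cF); rewrite ltnn.
Qed.

Hypothesis K_body : convex_body K.
Hypothesis K_sym : o_symmetric K.
Hypothesis K_reg : smooth K \/ strictly_convex K.

Lemma configuration_card n (F : 'I_n -> set 'rV[R]_d) :
  separable_Hadwiger_configuration K F -> (n <= 2 ^ d)%N.
Proof.
move=> cF; have [x FE] := configuration_translates cF; rewrite FE in cF.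
have [f [cf f0]] := configuration_contacts K_body K_sym K_reg cF.
apply: (@card_le_pow2 R d n x f) => [i|i j /eqP]; last exact: f0.
by case: (cf i).
Qed.

(** The matrix of the values [dot (f i) (x j)] has rank at most [d]. *)
Lemma configuration_partner n (x : 'I_n -> 'rV[R]_d) :
  (d <= 4)%N -> (2 * d <= n)%N ->
  separable_Hadwiger_configuration K (fun i => translate (2 *: x i) K) ->
  n = (2 * d)%N /\ exists f : 'I_n -> 'rV[R]_d,
    (forall i, contact K (x i) (f i)) /\
    forall i, exists j, [/\ dot (f i) (x j) = -1, dot (f j) (x i) = -1 &
      forall k, k != i -> k != j -> dot (f i) (x k) = 0].
Proof.
move=> d4 dn cx.
have [f [cf f0]] := configuration_contacts K_body K_sym K_reg cx.
pose A : 'M[R]_n := \matrix_(i, j) dot (f i) (x j).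
have rA : (\rank A <= d)%N.
  have -> : A = (\matrix_i f i) *m (\matrix_i x i)^T.
    by apply/matrixP=> i j; rewrite !mxE; apply: eq_bigr => k _; rewrite !mxE.
  by apply: leq_trans (mxrankM_maxl _ _) (rank_leq_col _).
have [|||nd partner] := opposite_partner d4 rA dn.
- by move=> i; rewrite mxE; case: (cf i).
- by move=> i j /eqP ij; rewrite mxE f0.
- have [opp|opp] := contacts_opposite K_body K_sym K_reg cf; [left|right] => i j;
    rewrite mxE => /opp ij k; rewrite !mxE ij; [exact: dotNr|exact: dotNl].
split=> //; exists f; split=> // i; have [j [Aij Aji A0]] := partner i.
exists j; move: Aij Aji; rewrite !mxE; split=> // k ki kj.
by have [] := A0 k ki kj; rewrite mxE.
Qed.

(** The members touch [K] at the points of an Auerbach basis and their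
    opposites. *)
Lemma cross_configuration :
  exists F : 'I_(2 * d) -> set 'rV[R]_d, separable_Hadwiger_configuration K F.
Proof.
have [b [f [cf fb]]] := Auerbach_exists K_body K_sym.
pose x (k : 'I_d * bool) := (-1) ^+ k.2 *: b k.1.
pose g (k : 'I_d * bool) := (-1) ^+ k.2 *: f k.1.
have cg k : contact K (x k) (g k).
  case: k => i []; rewrite /x /g /= ?expr1 ?expr0 ?scale1r // !scaleN1r.
  have [Kb fbi fK] := cf i; split; first exact: symN.
    by rewrite dotNl dotNr opprK.
  by move=> y /(symN K_sym) /fK; rewrite dotNl dotNr.
have g0 k l : k <> l -> dot (g k) (x l) <= 0.
  case: k l => [i s] [j t] ne; rewrite /x /g /= dotZl dotZr fb.
  have [ij|] := eqVneq i j; last by rewrite !mulr0.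
  move: ne; rewrite ij; case: s; case: t => // _;
    rewrite ?expr0 ?expr1 /= ?mulr1 ?mul1r; lra.
have cx := contacts_configuration K_sym cg g0.
have E : (2 * d)%N = #|{: 'I_d * bool}|.
  by rewrite card_prod card_ord card_bool mulnC.
exists ((fun k => translate (2 *: x k) K) \o (fun k => enum_val (cast_ord E k))).
by apply: configuration_sub cx => k l /enum_val_inj /cast_ord_inj.
Qed.

(** Picking one point from each pair of partners gives points and normals that
    are dual bases; expanding the partner of a point in such a basis shows that
    it is its opposite. *)
Lemma extremal_configuration (x : 'I_(2 * d) -> 'rV[R]_d) :
  (d <= 4)%N ->
  separable_Hadwiger_configuration K (fun i => translate (2 *: x i) K) ->
  exists p : 'I_d * bool -> 'I_(2 * d),
    [/\ bijective p,
        forall i, x (p (i, true)) = - x (p (i, false)) &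
        forall s : 'I_d -> bool, Auerbach_basis K (fun i => x (p (i, s i)))].
Proof.
move=> d4 cx.
have [_ [f [cf /choice[opp oppP]]]] := configuration_partner d4 (leqnn _) cx.
have fx i : dot (f i) (x i) = 1 by case: (cf i).
have neg1 : (-1 : R) != 1 by apply/eqP; lra.
have opp_neq i : opp i != i.
  by apply: contra_neq neg1 => oi; have [<- _ _] := oppP i; rewrite oi fx.
have opp_inv : involutive opp.
  move=> i; apply/eqP; apply: contraT => ooi.
  have [_ fo _] := oppP i; have [_ _ f0] := oppP (opp i).
  have := f0 i; rewrite fo eq_sym opp_neq eq_sym ooi => /(_ isT isT)/eqP.
  by rewrite oppr_eq0 oner_eq0.
have [p [pbij oppE]] := involution_pairs opp_inv opp_neq.
have pinj := bij_inj pbij.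
have dual (s : 'I_d -> bool) i j :
    dot (f (p (i, s i))) (x (p (j, s j))) = (i == j)%:R.
  have [->|ij] := eqVneq i j; first exact: fx.
  have [_ _] := oppP (p (i, s i)); rewrite oppE; apply; rewrite (inj_eq pinj);
    by apply: contra_neq ij => -[].
exists p; split=> [//|i|s].
- apply: oppr_inj; rewrite opprK [RHS](dual_expansion (dual (fun=> true))).
  rewrite (bigD1 i) //= big1 ?addr0 => [|j ji].
    have [fo _ _] := oppP (p (i, true)); move: fo; rewrite oppE /= => ->.
    by rewrite scaleN1r.
  have [_ _ ->] := oppP (p (j, true)); first by rewrite scale0r.
    by rewrite (inj_eq pinj); apply/eqP=> -[].
  by rewrite oppE (inj_eq pinj); apply: contra_neq ji => -[].
- exact: (contact_Auerbach (fun i => cf _) (dual s)).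
Qed.

End Configurations.

Theorem theorem1 (R : realType) (d : nat) (K : set 'rV[R]_d)
    (K_body : convex_body K) (K_sym : o_symmetric K)
    (K_reg : smooth K \/ strictly_convex K) :
  ((1 <= d <= 4)%N ->
     separable_Hadwiger_number K (2 * d)%N /\
     forall x : 'I_(2 * d) -> 'rV[R]_d,
       separable_Hadwiger_configuration K (fun i => translate (2 *: x i) K) ->
       exists p : 'I_d * bool -> 'I_(2 * d),
         [/\ bijective p,
             forall i, x (p (i, true)) = - x (p (i, false)) &
             forall s : 'I_d -> bool,
               Auerbach_basis K (fun i => x (p (i, s i)))]) /\
  ((5 <= d)%N ->
     exists2 n : nat, separable_Hadwiger_number K n &
       (n <= 2 ^ d.+1 - 3)%N).
Proof.
split=> [/andP[_ d4]|d5].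
  split; last by move=> x; exact: extremal_configuration.
  apply: separable_Hadwiger_number_max; first exact: cross_configuration.
  move=> m F cF; rewrite leqNgt; apply/negP=> dm.
  have [x FE] := configuration_translates cF; rewrite FE in cF.
  have [mE _] := configuration_partner K_body K_sym K_reg d4 (ltnW dm) cF.
  by rewrite mE ltnn in dm.
pose P n := `[< exists F : 'I_n -> set 'rV[R]_d,
  separable_Hadwiger_configuration K F >].
have P0 : exists n, P n.
  exists 0%N; apply/asboolP.
  exists (fun i : 'I_0 => translate (2 *: (fun=> 0) i) K).
  by apply: (@contacts_configuration _ _ _ K_sym _ _ (fun=> 0)) => -[].
have Pmax n : P n -> (n <= 2 ^ d)%N.
  by move=> /asboolP[F]; exact: configuration_card.
have [n /asboolP exn maxn] := ex_maxnP P0 Pmax.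
exists n.
  apply: separable_Hadwiger_number_max => // m F cF.
  by apply: maxn; apply/asboolP; exists F.
have nd : (n <= 2 ^ d)%N by apply: Pmax; exact/asboolP.
have d3 : (3 <= 2 ^ d)%N by apply: (@leq_trans (2 ^ 5)) => //; rewrite leq_exp2l.
by rewrite expnS mul2n -addnn -addnBA //; apply: leq_trans nd (leq_addr _ _).
Qed.
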